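(* Let $A\in\mathbb{H}^{n\times n}$ and write $A=A_1+A_2\mathbf{j}$ with $A_1,A_2\in\mathbb{C}^{n\times n}$. Define real $n\times n$ matrices $E_1,E_2,S_1,S_2$ (symmetric) and $F_1,F_2,T_1,T_2$ (skew-symmetric) by $$A_1=A_{11}+A_{21}\mathbf{i},\quad A_{11},A_{21}\ \text{complex Hermitian},\quad A_{11}=E_1+F_1\mathbf{i},\quad A_{21}=E_2+F_2\mathbf{i},$$ $$\tfrac12(A_2+A_2^\top)=S_1+S_2\mathbf{i},\qquad \tfrac12(A_2-A_2^\top)=T_1+T_2\mathbf{i}.$$ Define the following real matrices of order $4n$: $$C_1=\begin{bmatrix}E_1&T_1&-F_1&-T_2\\ -T_1&E_1&-T_2&F_1\\ F_1&T_2&E_1&T_1\\ T_2&-F_1&-T_1&E_1\end{bmatrix},\quad C_2=\begin{bmatrix}E_2&S_2&-F_2&S_1\\ S_2&-E_2&-S_1&-F_2\\ F_2&-S_1&E_2&S_2\\ S_1&F_2&S_2&-E_2\end{bmatrix},$$ $$C_3=\begin{bmatrix}S_1&F_2&S_2&-E_2\\ -F_2&S_1&-E_2&-S_2\\ S_2&-E_2&-S_1&-F_2\\ -E_2&-S_2&F_2&-S_1\end{bmatrix},\quad C_4=\begin{bmatrix}S_2&-E_2&-S_1&-F_2\\ -E_2&-S_2&F_2&-S_1\\ -S_1&-F_2&-S_2&E_2\\ F_2&-S_1&E_2&S_2\end{bmatrix}.$$ Then: (a) $C_1,C_2,C_3,C_4$ are real symmetric matrices. (b) Fix $t=t_1+t_2\mathbf{i}+t_3\mathbf{j}+t_4\mathbf{k}\in\mathbb{H}$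 with $(t_1,t_2,t_3,t_4)^\top\in\mathbb{R}^4$ of Euclidean norm $1$. The two supporting hyperplanes of $\mathrm{co}(\mathbf{W}(A))\subset\mathbb{H}\cong\mathbb{R}^4$ of the form $\Re(\bar t w)=\mathrm{const}$ are $$\Re(\bar t w)=\lambda_{\min}\Big(\sum_{l=1}^4 t_lC_l\Big),\qquad \Re(\bar t w)=\lambda_{\max}\Big(\sum_{l=1}^4 t_lC_l\Big).$$ That is, every $w\in\mathrm{co}(\mathbf{W}(A))$ satisfies $$\lambda_{\min}\Big(\sum_{l=1}^4 t_lC_l\Big)\le\Re(\bar t w)\le\lambda_{\max}\Big(\sum_{l=1}^4 t_lC_l\Big),$$ and both inequalities are sharp (each is an equality for some $w\in\mathrm{co}(\mathbf{W}(A))$). (c) The numerical radius of $A$ is $$r(A)=\max_{\mathbf{t}\in\mathbb{R}^4,\,\|\mathbf{t}\|=1}\lambda_{\max}\Big(\sum_{l=1}^4 t_lC_l\Big)=\max_{\mathbf{t}\in\mathbb{R}^4,\,\|\mathbf{t}\|\le1}\lambda_{\max}\Big(\sum_{l=1}^4 t_lC_l\Big).$$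
   Context: $\mathbb{H}$ is the skew-field of quaternions $q=q_1+q_2\mathbf{i}+q_3\mathbf{j}+q_4\mathbf{k}$, $q_i\in\mathbb{R}$, with $\Re q=q_1$, conjugate $\bar q=q_1-q_2\mathbf{i}-q_3\mathbf{j}-q_4\mathbf{k}$ and $|q|=\sqrt{q_1^2+q_2^2+q_3^2+q_4^2}$; $\mathbb{C}=\mathbb{R}+\mathbb{R}\mathbf{i}\subset\mathbb{H}$, and every quaternionic matrix is uniquely $A_1+A_2\mathbf{j}$ with $A_1,A_2$ complex matrices. For a quaternionic matrix, $A^*$ is the conjugate transpose; for $\mathbf{x}\in\mathbb{H}^n$ (column vectors) $\|\mathbf{x}\|=\sqrt{\mathbf{x}^*\mathbf{x}}$. For $A\in\mathbb{H}^{n\times n}$, the numerical range is $\mathbf{W}(A)=\{\mathbf{x}^*A\mathbf{x}:\mathbf{x}\in\mathbb{H}^n,\|\mathbf{x}\|=1\}\subset\mathbb{H}$ and the numerical radius is $r(A)=\max\{|\mathbf{x}^*A\mathbf{x}|:\mathbf{x}\in\mathbb{H}^n,\|\mathbf{x}\|=1\}$. $\mathrm{co}(\cdot)$ denotes the convex hull in $\mathbb{H}\cong\mathbb{R}^4$. $\lambda_{\max},\lambda_{\min}$ denote the largest and smallest eigenvalue of a real symmetric matrix. *)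

(* Defs.v *)
From HB Require Import structures.
From mathcomp Require Import all_boot all_order all_algebra sesquilinear spectral.
From mathcomp Require Import ring complex.
From mathcomp Require Import boolp classical_sets reals convex.

Set Implicit Arguments.
Unset Strict Implicit.
Unset Printing Implicit Defensive.

Import Order.TTheory GRing.Theory Num.Theory.

Local Open Scope ring_scope.
Local Open Scope classical_set_scope.

(* [Quat a b c d] is a + b i + c j + d k. *)
Record quaternion (R : Type) := Quat { q1 : R; q2 : R; q3 : R; q4 : R }.

Section QuaternionChoice.
Variable R : Type.

Definition tuple_of_quat (p : quaternion R) := (q1 p, q2 p, q3 p, q4 p).
Definition quat_of_tuple (p : R * R * R * R) :=
  let: (a, b, c, d) := p in Quat a b c d.

Lemma tuple_of_quatK : cancel tuple_of_quat quat_of_tuple.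
Proof. by case. Qed.

End QuaternionChoice.

HB.instance Definition _ (R : eqType) := Equality.copy (quaternion R)
  (can_type (@tuple_of_quatK R)).
HB.instance Definition _ (R : choiceType) := Choice.copy (quaternion R)
  (can_type (@tuple_of_quatK R)).

Section QuaternionRing.
Variable R : comNzRingType.
Implicit Types p q : quaternion R.

Definition addq p q :=
  Quat (q1 p + q1 q) (q2 p + q2 q) (q3 p + q3 q) (q4 p + q4 q).
Definition oppq p := Quat (- q1 p) (- q2 p) (- q3 p) (- q4 p).
Definition scaleq (a : R) p := Quat (a * q1 p) (a * q2 p) (a * q3 p) (a * q4 p).
Definition mulq p q :=
  Quat (q1 p * q1 q - q2 p * q2 q - q3 p * q3 q - q4 p * q4 q)
       (q1 p * q2 q + q2 p * q1 q + q3 p * q4 q - q4 p * q3 q)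
       (q1 p * q3 q - q2 p * q4 q + q3 p * q1 q + q4 p * q2 q)
       (q1 p * q4 q + q2 p * q3 q - q3 p * q2 q + q4 p * q1 q).

Lemma addqA : associative addq.
Proof. by move=> p q r; congr Quat; rewrite /= addrA. Qed.
Lemma addqC : commutative addq.
Proof. by move=> p q; congr Quat; rewrite addrC. Qed.
Lemma add0q : left_id (Quat 0 0 0 0) addq.
Proof. by case=> a b c d; congr Quat; rewrite /= add0r. Qed.
Lemma addNq : left_inverse (Quat 0 0 0 0) oppq addq.
Proof. by case=> a b c d; congr Quat; rewrite /= addNr. Qed.

HB.instance Definition _ :=
  GRing.isZmodule.Build (quaternion R) addqA addqC add0q addNq.

Lemma mulqA : associative mulq.
Proof. by move=> p q r; congr Quat; rewrite /=; ring. Qed.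
Lemma mul1q : left_id (Quat 1 0 0 0) mulq.
Proof. by case=> a b c d; congr Quat; rewrite /=; ring. Qed.
Lemma mulq1 : right_id (Quat 1 0 0 0) mulq.
Proof. by case=> a b c d; congr Quat; rewrite /=; ring. Qed.
Lemma mulqDl : left_distributive mulq addq.
Proof. by move=> p q r; congr Quat; rewrite /=; ring. Qed.
Lemma mulqDr : right_distributive mulq addq.
Proof. by move=> p q r; congr Quat; rewrite /=; ring. Qed.
Lemma oneq_neq0 : Quat 1 0 0 0 != 0 :> quaternion R.
Proof. by apply/eqP => -[]; apply/eqP; rewrite oner_eq0. Qed.

HB.instance Definition _ := GRing.Zmodule_isNzRing.Build (quaternion R)
  mulqA mul1q mulq1 mulqDl mulqDr oneq_neq0.

Lemma scaleqA a b p : scaleq a (scaleq b p) = scaleq (a * b) p.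
Proof. by congr Quat; rewrite /= mulrA. Qed.
Lemma scale1q : left_id 1 scaleq.
Proof. by case=> a b c d; congr Quat; rewrite /= mul1r. Qed.
Lemma scaleqDr : right_distributive scaleq +%R.
Proof. by move=> a p q; congr Quat; rewrite /= mulrDr. Qed.
Lemma scaleqDl p : {morph scaleq^~ p : a b / a + b}.
Proof. by move=> a b; congr Quat; rewrite /= mulrDl. Qed.

HB.instance Definition _ := GRing.Zmodule_isLmodule.Build R (quaternion R)
  scaleqA scale1q scaleqDr scaleqDl.

Definition conjq p := Quat (q1 p) (- q2 p) (- q3 p) (- q4 p).
Definition quat_j : quaternion R := Quat 0 0 1 0.
Definition quat_of_complex (z : complex R) : quaternion R :=
  let: Complex a b := z in Quat a b 0 0.

Definition adjq m n (X : 'M[quaternion R]_(m, n)) : 'M[quaternion R]_(n, m) :=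
  map_mx conjq X^T.

End QuaternionRing.
Arguments quat_j {R}.

(* Real and complex matrices X, Y give X + Y i and X + Y j respectively. *)
Definition complex_mx (R : realType) n (X Y : 'M[R]_n) : 'M[complex R]_n :=
  map_mx (fun a => Complex a 0) X + Complex 0 1 *: map_mx (fun a => Complex a 0) Y.
Definition quaternion_mx (R : realType) n (X Y : 'M[complex R]_n) :
    'M[quaternion R]_n :=
  map_mx (@quat_of_complex R) X + map_mx (fun z => quat_of_complex z * quat_j) Y.

Section Extrema.
Variable R : realType.
Implicit Type S : set R.

Definition is_max S m := S m /\ ubound S m.
Definition is_min S m := S m /\ lbound S m.

(* Defaults to 0 when the extremum does not exist. *)
Definition max_of S : R := xget 0 [set m | is_max S m].
Definition min_of S : R := xget 0 [set m | is_min S m].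

Definition lambda_max m (M : 'M[R]_m) := max_of [set a | eigenvalue M a].
Definition lambda_min m (M : 'M[R]_m) := min_of [set a | eigenvalue M a].

End Extrema.

Section NumericalRange.
Variable R : realType.
Local Notation H := (quaternion R).

Definition absq (q : H) : R :=
  Num.sqrt (q1 q ^+ 2 + q2 q ^+ 2 + q3 q ^+ 2 + q4 q ^+ 2).

(* The quaternion x^* x is real, so it equals its real part. *)
Definition normqv n (x : 'cV[H]_n) : R := Num.sqrt (q1 ((adjq x *m x) 0 0)).

Definition numerical_range n (A : 'M[H]_n) : set H :=
  [set (adjq x *m A *m x) 0 0 | x in [set x : 'cV[H]_n | normqv x = 1]].

Definition numerical_radius n (A : 'M[H]_n) : R :=
  max_of [set absq ((adjq x *m A *m x) 0 0)
         | x in [set x : 'cV[H]_n | normqv x = 1]].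

Definition convex_hull (V : lmodType R) (S : set V) : set V :=
  smallest (@convex_set R V) S.

(* The hyperplane Re (conj t * w) = c touches S and leaves S on one side;
   meaningful for t != 0. *)
Definition supporting_hyperplane (S : set H) (t : H) (c : R) : Prop :=
  (exists2 w, S w & q1 (conjq t * w) = c) /\
  ((forall w, S w -> q1 (conjq t * w) <= c) \/
   (forall w, S w -> c <= q1 (conjq t * w))).

End NumericalRange.

(* Entries in row-major order. *)
Definition block4_mx (R : Type) n
    (M11 M12 M13 M14 M21 M22 M23 M24 M31 M32 M33 M34 M41 M42 M43 M44 : 'M[R]_n) :
    'M[R]_((n + n) + (n + n)) :=
  block_mx (block_mx M11 M12 M21 M22) (block_mx M13 M14 M23 M24)
           (block_mx M31 M32 M41 M42) (block_mx M33 M34 M43 M44).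

(* Main.v *)
Require Import Defs.
From HB Require Import structures.
From mathcomp Require Import all_boot all_order all_algebra sesquilinear spectral.
From mathcomp Require Import complex.
From mathcomp Require Import ring lra.
From mathcomp Require Import boolp classical_sets reals.
From mathcomp Require Import interval_inference convex topology normedtype derive.

(** Writing a column x = a + b i + c j + d k with real columns a, b, c, d turns
    Re (conj t * (x^* A x)) into a real quadratic form in the 4n coordinates
    of x.  Skew-symmetric blocks disappear from a quadratic form and products
    in the two possible orders can be merged, so this form has a unique
    symmetric matrix; in the coordinates (a, -c, b, d) that matrix is
    t1 C1 + t2 C2 + t3 C3 + t4 C4 ([quadratic_form_components]).  The order
    and the sign come from the complex representation
    [A1, A2; - conj A2, conj A1] of A, which acts on the pair
    (a + b i, - conj (c + d i)).

    As x runs over the unit sphere of H^n, its coordinates run over the whole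
    unit sphere of R^(4n).  By the Rayleigh principle ([rayleigh_max],
    [rayleigh_min]) the functional w |-> Re (conj t * w) therefore has maximum
    lambda_max and minimum lambda_min of the pencil on the numerical range.
    The convex hull has the same extrema, because closed half-spaces are
    convex; a supporting hyperplane orthogonal to t must sit at one of these
    two values, which is (b).

    For (c), |w| is the maximum of Re (conj t * w) over unit t: one inequality
    is Cauchy-Schwarz, and t = w / |w| gives equality.  Exchanging the two
    maxima, over t and over the numerical range, gives the formula for the
    numerical radius, and Cauchy-Schwarz bounds the pencil on the whole unit
    ball.  The maxima exist since real unit spheres are compact. *)

Set Implicit Arguments.
Unset Strict Implicit.
Unset Printing Implicit Defensive.

Import Order.TTheory GRing.Theory Num.Theory numFieldNormedType.Exports.
Local Open Scope ring_scope.
Local Open Scope classical_set_scope.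

(** * Quadratic forms of real symmetric matrices *)

Section RealSymmetric.
Context {R : realType} {m : nat}.
Implicit Types (M N : 'M[R]_m) (u v : 'rV[R]_m).

Definition qform M v : R := (v *m M *m v^T) 0 0.
Definition sqnorm v : R := (v *m v^T) 0 0.

Lemma bilinear_form_entry M u v :
  (u *m M *m v^T) 0 0 = \sum_i \sum_j u 0 i * M i j * v 0 j.
Proof.
rewrite mxE exchange_big; apply: eq_bigr => j _ /=.
by rewrite mxE mulr_suml; apply: eq_bigr => i _; rewrite mxE.
Qed.

Lemma sqnormE v : sqnorm v = \sum_i v 0 i ^+ 2.
Proof. by rewrite /sqnorm mxE; apply: eq_bigr => i _; rewrite mxE expr2. Qed.

Lemma qform1 v : qform 1%:M v = sqnorm v.
Proof. by rewrite /qform mulmx1. Qed.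

Lemma sqnorm_ge0 v : 0 <= sqnorm v.
Proof. by rewrite sqnormE sumr_ge0 // => i _; rewrite sqr_ge0. Qed.

Lemma sqnorm_eq0 v : (sqnorm v == 0) = (v == 0).
Proof.
apply/eqP/eqP => [|->]; last by rewrite /sqnorm mul0mx mxE.
rewrite sqnormE => /eqP; rewrite psumr_eq0 => [/allP v0|i _]; last exact: sqr_ge0.
apply/rowP => i; rewrite mxE; apply/eqP.
by rewrite -sqrf_eq0; apply: (v0 i); rewrite mem_index_enum.
Qed.

Lemma qformZ M a v : qform M (a *: v) = a ^+ 2 * qform M v.
Proof.
rewrite /qform linearZ /= -!scalemxAl -scalemxAr !mxE.
by rewrite mulrA expr2.
Qed.

Lemma sqnormZ a v : sqnorm (a *: v) = a ^+ 2 * sqnorm v.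
Proof. by rewrite -!qform1 qformZ. Qed.

Lemma qform_add M N v : qform (M + N) v = qform M v + qform N v.
Proof. by rewrite /qform mulmxDr mulmxDl mxE. Qed.

Lemma qform_scale a M v : qform (a *: M) v = a * qform M v.
Proof. by rewrite /qform -scalemxAr -scalemxAl mxE. Qed.

Lemma qform_opp M v : qform (- M) v = - qform M v.
Proof. by rewrite /qform mulmxN mulNmx mxE. Qed.

Lemma symmetricmxP M : reflect (M^T = M) (M \is symmetricmx).
Proof.
by apply: (iffP (is_hermitianmxP _ _ _)); rewrite expr0 scale1r map_mx_id.
Qed.

Lemma skewmxP M : reflect (M^T = - M) (M \is skewmx).
Proof.
apply: (iffP (is_hermitianmxP _ _ _)); rewrite expr1 scaleN1r map_mx_id //.
  by move=> {2}->; rewrite opprK.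
by move=> ->; rewrite opprK.
Qed.

Lemma qform_scalar_sub M a v : qform (a%:M - M) v = a * sqnorm v - qform M v.
Proof.
by rewrite qform_add qform_opp -scalemx1 qform_scale qform1.
Qed.

Lemma qform_addZ N u v s : N \is symmetricmx ->
  qform N (v + s *: u) =
    qform N v + s * (v *m N *m u^T) 0 0 *+ 2 + s ^+ 2 * qform N u.
Proof.
move=> /symmetricmxP Nsym.
have swap : (u *m N *m v^T) 0 0 = (v *m N *m u^T) 0 0.
  rewrite [RHS](_ : _ = (v *m N *m u^T)^T 0 0); last by rewrite [RHS]mxE.
  by rewrite !trmx_mul trmxK Nsym mulmxA.
rewrite /qform linearD linearZ /= !mulmxDl !mulmxDr -!scalemxAl -!scalemxAr.
move: swap; move: (u *m _ *m v^T) (v *m _ *m u^T) (u *m _ *m u^T) => X Y Z XY.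
by rewrite [LHS]mxE !mxE XY; ring.
Qed.

(** At an isotropic vector v the form attains its minimum 0, so its gradient
    vanishes there: the value at v - s (v N) has derivative
    - 2 |v N|^2 at s = 0. *)
Lemma psd_isotropic_kernel N v : N \is symmetricmx ->
  (forall u, 0 <= qform N u) -> qform N v = 0 -> v *m N = 0.
Proof.
move=> Nsym Npsd v0; set w := v *m N; apply/eqP; rewrite -sqnorm_eq0.
have q0 := Npsd w; set q := qform N w in q0.
(* With q the value of N at v N, the value at v - s (v N) is least at
   s = |v N|^2 / q; with q + 1 in place of q it is still negative, unless
   v N = 0, and there is no division by zero. *)
have := Npsd (v + (- (sqnorm w / (q + 1))) *: w).
rewrite qform_addZ // v0 add0r -/q -/w -/(sqnorm w).
set d := sqnorm w.
rewrite [X in 0 <= X](_ : _ = - (d ^+ 2 * ((q + 2) / (q + 1) ^+ 2))); last first.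
  by field; rewrite gt_eqF //; lra.
rewrite oppr_ge0 => le0; rewrite -sqrf_eq0 eq_le sqr_ge0 andbT.
by rewrite -(pmulr_lle0 _ (_ : 0 < (q + 2) / (q + 1) ^+ 2)) // divr_gt0 ?exprn_gt0 //; lra.
Qed.

End RealSymmetric.

Lemma qform_continuous {R : realType} {m} (M : 'M[R]_m) :
  continuous (qform M).
Proof.
rewrite (_ : qform M = fun v => \sum_i \sum_j v 0 i * M i j * v 0 j); last first.
  by apply/funext => v; exact: bilinear_form_entry.
have csum (I : Type) (r : seq I) (f : I -> 'rV[R]_m -> R) :
    (forall i, continuous (f i)) -> continuous (fun v => \sum_(i <- r) f i v).
  move=> cf; elim: r => [|i r IH] v.
    by under eq_fun do rewrite big_nil; exact: cst_continuous.
  by under eq_fun do rewrite big_cons; apply: continuousD; [exact: cf|exact: IH].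
apply: (csum) => i; apply: (csum) => j v.
apply: (@cvgM _ _ (nbhs v) _ (fun u => u 0 i * M i j)); last exact: coord_continuous.
by apply: (@cvgM _ _ (nbhs v) _ (fun u => u 0 i)); [exact: coord_continuous|exact: cvg_cst].
Qed.

(** The sphere is a closed subset of the cube [-1, 1]^m. *)
Lemma unit_sphere_compact (R : realType) m :
  compact [set v : 'rV[R]_m | sqnorm v = 1].
Proof.
have cube : compact [set v : 'rV[R]_m | forall i, v ord0 i \in `[-1, 1]%R].
  have segment (i : 'I_m) : compact `[- 1 : R, 1]%classic.
    exact: segment_compact.
  exact: (rV_compact segment).
apply: (subclosed_compact _ cube) => [|v /= v1 i].
  apply: (@preimage_closed _ _ (@sqnorm R m) [set x | x = 1]); last exact: closed_eq.
  by move=> v _; rewrite (_ : sqnorm = qform 1%:M);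
    [exact: qform_continuous|apply/funext => u; rewrite qform1].
rewrite /= in_itv /= -ler_norml -(@expr_le1 _ 2%N) // -normrX ger0_norm ?sqr_ge0 //.
rewrite -v1 sqnormE (bigD1 i) //= lerDl sumr_ge0 // => j _; exact: sqr_ge0.
Qed.

Lemma unit_sphere_neq0 (R : realType) m : (0 < m)%N ->
  [set v : 'rV[R]_m | sqnorm v = 1] !=set0.
Proof.
case: m => // m _; exists (delta_mx 0 0); rewrite /= sqnormE (bigD1 0) //= big1.
  by rewrite !mxE eqxx expr1n addr0.
by move=> i /negbTE i0; rewrite mxE i0 andbF expr0n.
Qed.

(** * The Rayleigh principle *)

Section Rayleigh.
Variable R : realType.

Lemma max_ofP (S : set R) a : is_max S a -> max_of S = a.
Proof.
move=> Sa; apply: xget_unique => // b [Sb ub].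
by case: Sa => Sa ua; apply/eqP; rewrite eq_le ua // ub.
Qed.

Lemma min_ofP (S : set R) a : is_min S a -> min_of S = a.
Proof.
move=> Sa; apply: xget_unique => // b [Sb ub].
by case: Sa => Sa ua; apply/eqP; rewrite eq_le ua // ub.
Qed.

(** A maximiser v of the form on the unit sphere exists by compactness; if a is
    the maximum, a I - M is positive semidefinite and isotropic at v, so that
    v is an eigenvector for a.  Conversely an eigenvalue is the value of the
    form at a normalised eigenvector, hence at most a. *)
Lemma rayleigh_principle m (M : 'M[R]_m) : (0 < m)%N -> M \is symmetricmx ->
  exists a, is_max [set a | eigenvalue M a] a /\
            is_max [set qform M v | v in [set v | sqnorm v = 1]] a.
Proof.
move=> m_gt0 Msym.
have [v /[!inE] /= v1 vmax] := compact_EVT_max (unit_sphere_neq0 R m_gt0)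
  (@unit_sphere_compact R m) (continuous_subspaceT (@qform_continuous R m M)).
set a := qform M v in vmax.
have le_a u : qform M u <= a * sqnorm u.
  have [->|u0] := eqVneq u 0.
    by rewrite /qform /sqnorm !mul0mx mxE mulr0.
  have u_gt0 : 0 < sqnorm u by rewrite lt_def sqnorm_eq0 u0 sqnorm_ge0.
  have := vmax ((Num.sqrt (sqnorm u))^-1 *: u).
  rewrite inE /= sqnormZ qformZ exprVn sqr_sqrtr ?sqnorm_ge0 // mulVf ?gt_eqF //.
  by move=> /(_ erefl); rewrite mulrC ler_pdivrMr.
exists a; split; last first.
  by split=> [|_ [u /= u1 <-]]; [exists v|apply: vmax; rewrite inE].
split.
  apply/eigenvalueP; exists v; last first.
    by rewrite -sqnorm_eq0 v1 oner_eq0.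
  apply/esym/eqP; rewrite -subr_eq0 -mul_mx_scalar -mulmxBr.
  apply/eqP/psd_isotropic_kernel => [|u|].
  - apply/symmetricmxP; rewrite linearB /= tr_scalar_mx.
    by rewrite (symmetricmxP _ Msym).
  - by rewrite qform_scalar_sub subr_ge0.
  - by rewrite qform_scalar_sub v1 mulr1 subrr.
move=> b /eigenvalueP [u ub u0].
have u_gt0 : 0 < sqnorm u by rewrite lt_def sqnorm_eq0 u0 sqnorm_ge0.
by have := le_a u; rewrite {1}/qform ub -scalemxAl mxE ler_pM2r.
Qed.

Lemma eigenvalueN m (M : 'M[R]_m) a : eigenvalue (- M) a = eigenvalue M (- a).
Proof.
apply/eigenvalueP/eigenvalueP => -[v va v0]; exists v => //.
  by rewrite scaleNr -va mulmxN opprK.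
by rewrite mulmxN va scaleNr opprK.
Qed.

Lemma is_min_opp (S : set R) a : is_min S a <-> is_max [set x | S (- x)] (- a).
Proof.
rewrite /is_min /is_max /= opprK; split=> -[Sa b]; split=> // x Sx.
  by rewrite lerNr; exact: b.
by rewrite -lerN2; apply: b; rewrite /= opprK.
Qed.

Lemma rayleigh_max m (M : 'M[R]_m) : (0 < m)%N -> M \is symmetricmx ->
  is_max [set qform M v | v in [set v | sqnorm v = 1]] (lambda_max M).
Proof.
move=> m_gt0 Msym; have [a [eiga qa]] := rayleigh_principle m_gt0 Msym.
by rewrite /lambda_max (max_ofP eiga).
Qed.

Lemma rayleigh_min m (M : 'M[R]_m) : (0 < m)%N -> M \is symmetricmx ->
  is_min [set qform M v | v in [set v | sqnorm v = 1]] (lambda_min M).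
Proof.
move=> m_gt0 Msym.
have NMsym : - M \is symmetricmx.
  by apply/symmetricmxP; rewrite linearN /= (symmetricmxP _ Msym).
have [a [eiga qa]] := rayleigh_principle m_gt0 NMsym.
have -> : lambda_min M = - a.
  apply: min_ofP; apply/is_min_opp; rewrite opprK.
  have -> // : [set x | [set b | eigenvalue M b] (- x)] = [set b | eigenvalue (- M) b].
  by apply/funext => b /=; rewrite eigenvalueN.
apply/is_min_opp; rewrite opprK.
suff -> : [set x | [set qform M v | v in [set v | sqnorm v = 1]] (- x)] =
  [set qform (- M) v | v in [set v | sqnorm v = 1]] by exact: qa.
apply/funext => b; apply/propext; split=> /= -[v v1 vb]; exists v => //.
  by rewrite qform_opp vb opprK.
by rewrite -vb qform_opp opprK.
Qed.

End Rayleigh.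

(** * Quaternionic vectors in real coordinates *)

Section QuaternionForms.
Variable R : realType.
Local Notation H := (quaternion R).

Lemma q1_additive : zmod_morphism (@q1 R). Proof. by []. Qed.
Lemma q2_additive : zmod_morphism (@q2 R). Proof. by []. Qed.
Lemma q3_additive : zmod_morphism (@q3 R). Proof. by []. Qed.
Lemma q4_additive : zmod_morphism (@q4 R). Proof. by []. Qed.
HB.instance Definition _ := Algebra.isZmodMorphism.Build H R (@q1 R) q1_additive.
HB.instance Definition _ := Algebra.isZmodMorphism.Build H R (@q2 R) q2_additive.
HB.instance Definition _ := Algebra.isZmodMorphism.Build H R (@q3 R) q3_additive.
HB.instance Definition _ := Algebra.isZmodMorphism.Build H R (@q4 R) q4_additive.

(** The minus sign on the j-part and its place before the i-part match the
    layout of the block matrices: these are the real coordinates of the pair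
    (z, - conj w) when x = z + w j with z and w complex. *)
Definition realify n (x : 'cV[H]_n) : 'rV[R]_((n + n) + (n + n)) :=
  row_mx (row_mx (\row_i q1 (x i 0)) (\row_i - q3 (x i 0)))
         (row_mx (\row_i q2 (x i 0)) (\row_i q4 (x i 0))).

Definition quaternify n (v : 'rV[R]_((n + n) + (n + n))) : 'cV[H]_n :=
  \col_i Quat (lsubmx (lsubmx v) 0 i) (lsubmx (rsubmx v) 0 i)
              (- rsubmx (lsubmx v) 0 i) (rsubmx (rsubmx v) 0 i).

Lemma quaternifyK n : cancel (@quaternify n) (@realify n).
Proof.
move=> v; rewrite -[RHS]hsubmxK -[lsubmx v in RHS]hsubmxK -[rsubmx v in RHS]hsubmxK.
by congr row_mx; congr row_mx; apply/rowP => i; rewrite !mxE /= ?opprK ?mxE.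
Qed.

Lemma qform_block4 n (a b c d : 'rV[R]_n)
    (M11 M12 M13 M14 M21 M22 M23 M24 M31 M32 M33 M34 M41 M42 M43 M44 : 'M[R]_n) :
  qform (block4_mx M11 M12 M13 M14 M21 M22 M23 M24 M31 M32 M33 M34 M41 M42 M43 M44)
        (row_mx (row_mx a b) (row_mx c d)) =
  \sum_i \sum_j
    (a 0 i * M11 i j * a 0 j + a 0 i * M12 i j * b 0 j
       + a 0 i * M13 i j * c 0 j + a 0 i * M14 i j * d 0 j
   + (b 0 i * M21 i j * a 0 j + b 0 i * M22 i j * b 0 j
       + b 0 i * M23 i j * c 0 j + b 0 i * M24 i j * d 0 j)
   + (c 0 i * M31 i j * a 0 j + c 0 i * M32 i j * b 0 j
       + c 0 i * M33 i j * c 0 j + c 0 i * M34 i j * d 0 j)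
   + (d 0 i * M41 i j * a 0 j + d 0 i * M42 i j * b 0 j
       + d 0 i * M43 i j * c 0 j + d 0 i * M44 i j * d 0 j)).
Proof.
under eq_bigr => i _ do rewrite !big_split /=.
rewrite !big_split /= -!bilinear_form_entry.
rewrite /qform /block4_mx !mul_row_block !tr_row_mx !mul_row_col.
rewrite !add_row_mx !mul_row_col !mulmxDl.
have addE (X Y : 'M[R]_1) : (X + Y) 0 0 = X 0 0 + Y 0 0 by rewrite mxE.
rewrite !addE.
ring.
Qed.

Lemma normqv_realify n (x : 'cV[H]_n) :
  normqv x = Num.sqrt (sqnorm (realify x)).
Proof.
rewrite /normqv; congr Num.sqrt.
rewrite sqnormE !big_split_ord /= mxE raddf_sum -!big_split /=.
apply: eq_bigr => i _.
rewrite !(row_mxEl, row_mxEr) !mxE /=.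
by ring.
Qed.

Lemma unit_normqv n (x : 'cV[H]_n) : normqv x = 1 <-> sqnorm (realify x) = 1.
Proof.
rewrite normqv_realify; split=> [s1|->]; last exact: sqrtr1.
by rewrite -(sqr_sqrtr (sqnorm_ge0 _)) s1 expr1n.
Qed.

(** Only the symmetric part of the summand matters; this lets identities
    between quadratic forms be checked one pair of entries at a time. *)
Lemma double_sum_sym n (f g : 'I_n -> 'I_n -> R) :
  (forall i j, f i j + f j i = g i j + g j i) ->
  \sum_i \sum_j f i j = \sum_i \sum_j g i j.
Proof.
move=> fg.
have sym2 (h : 'I_n -> 'I_n -> R) :
    (\sum_i \sum_j h i j) *+ 2 = \sum_i \sum_j (h i j + h j i).
  under [RHS]eq_bigr => i _ do rewrite big_split /=.
  by rewrite big_split /= mulr2n; congr (_ + _); rewrite exchange_big.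
apply: (@pmulrnI R 2) => //=.
rewrite !sym2; apply: eq_bigr => i _; apply: eq_bigr => j _; exact: fg.
Qed.

(** * The four block matrices *)

Section Blocks.
Variables (n : nat) (E1 E2 F1 F2 S1 S2 T1 T2 : 'M[R]_n).

Definition re_mx := block4_mx
     E1    T1  (- F1) (- T2)
  (- T1)   E1  (- T2)    F1
     F1    T2     E1     T1
     T2 (- F1) (- T1)    E1.
Definition imi_mx := block4_mx
     E2    S2  (- F2)    S1
     S2 (- E2) (- S1) (- F2)
     F2 (- S1)    E2     S2
     S1    F2     S2  (- E2).
Definition imj_mx := block4_mx
     S1    F2     S2  (- E2)
  (- F2)   S1  (- E2) (- S2)
     S2 (- E2) (- S1) (- F2)
  (- E2) (- S2)   F2  (- S1).
Definition imk_mx := block4_mx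
     S2 (- E2) (- S1) (- F2)
  (- E2) (- S2)   F2  (- S1)
  (- S1) (- F2) (- S2)   E2
     F2 (- S1)    E2     S2.

Hypotheses (E1s : E1^T = E1) (E2s : E2^T = E2) (S1s : S1^T = S1) (S2s : S2^T = S2).
Hypotheses (F1s : F1^T = - F1) (F2s : F2^T = - F2) (T1s : T1^T = - T1) (T2s : T2^T = - T2).

Lemma re_mx_sym : re_mx^T = re_mx.
Proof.
by rewrite /re_mx /block4_mx !tr_block_mx ?linearN /= E1s F1s T1s T2s !opprK.
Qed.
Lemma imi_mx_sym : imi_mx^T = imi_mx.
Proof.
by rewrite /imi_mx /block4_mx !tr_block_mx ?linearN /= E2s F2s S1s S2s !opprK.
Qed.
Lemma imj_mx_sym : imj_mx^T = imj_mx.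
Proof.
by rewrite /imj_mx /block4_mx !tr_block_mx ?linearN /= E2s F2s S1s S2s !opprK.
Qed.
Lemma imk_mx_sym : imk_mx^T = imk_mx.
Proof.
by rewrite /imk_mx /block4_mx !tr_block_mx ?linearN /= E2s F2s S1s S2s !opprK.
Qed.

Variable A : 'M[H]_n.
(* The real coordinates of A1 + A2 j. *)
Hypothesis A_entries : forall i j,
  A i j = Quat (E1 i j - F2 i j) (F1 i j + E2 i j) (S1 i j + T1 i j) (S2 i j + T2 i j).

Lemma sesquilinear_entry (x : 'cV[H]_n) :
  (adjq x *m A *m x) 0 0 = \sum_i \sum_j conjq (x i 0) * A i j * x j 0.
Proof.
rewrite mxE exchange_big; apply: eq_bigr => j _ /=.
by rewrite mxE mulr_suml; apply: eq_bigr => i _; rewrite !mxE.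
Qed.

Let eT (M N : 'M[R]_n) : M^T = N -> forall i j, M j i = N i j.
Proof. by move=> <- i j; rewrite mxE. Qed.

(** Each side is a double sum over entries.  The summands differ, but their
    symmetrisations agree once the entries at (j, i) are expressed through
    those at (i, j). *)
Lemma quadratic_form_components (x : 'cV[H]_n) :
  [/\ q1 ((adjq x *m A *m x) 0 0) = qform re_mx (realify x),
      q2 ((adjq x *m A *m x) 0 0) = qform imi_mx (realify x),
      q3 ((adjq x *m A *m x) 0 0) = qform imj_mx (realify x) &
      q4 ((adjq x *m A *m x) 0 0) = qform imk_mx (realify x)].
Proof.
rewrite sesquilinear_entry; split; rewrite raddf_sum qform_block4;
  under eq_bigr => i _ do rewrite raddf_sum;
  apply: double_sum_sym => i j; rewrite !A_entries !mxE /=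
   ?(eT E1s i j) ?(eT E2s i j) ?(eT S1s i j) ?(eT S2s i j)
   ?(eT F1s i j) ?(eT F2s i j) ?(eT T1s i j) ?(eT T2s i j) !mxE;
  by ring.
Qed.

End Blocks.
End QuaternionForms.

(** * Half-spaces in the quaternions *)

Section HalfSpaces.
Variable R : realType.
Local Notation H := (quaternion R).

Lemma re_conjM (t w : H) :
  q1 (conjq t * w) = q1 t * q1 w + q2 t * q2 w + q3 t * q3 w + q4 t * q4 w.
Proof. by case: t w => [? ? ? ?] [? ? ? ?] /=; ring. Qed.

Lemma absq_ge0 (t : H) : 0 <= absq t. Proof. exact: sqrtr_ge0. Qed.

Lemma sqr_absq (t : H) : absq t ^+ 2 = q1 (conjq t * t).
Proof.
by rewrite /absq sqr_sqrtr ?re_conjM -?expr2 // !addr_ge0 ?sqr_ge0.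
Qed.

Lemma absq_eq0 (t : H) : absq t = 0 -> t = 0.
Proof.
move=> t0; have := sqr_absq t; rewrite t0 re_conjM expr0n.
case: t {t0} => a b c d /= /esym abcd.
have [a0 b0 c0 d0] : [/\ a = 0, b = 0, c = 0 & d = 0] by split; nra.
by rewrite a0 b0 c0 d0.
Qed.

Lemma absqZ a (t : H) : absq (a *: t) = `|a| * absq t.
Proof.
rewrite -[in RHS]sqrtr_sqr /absq -sqrtrM ?sqr_ge0 //; congr Num.sqrt.
by case: t => ? ? ? ? /=; ring.
Qed.

(** Cauchy-Schwarz in R^4, from Lagrange's identity for the defect. *)
Lemma re_conj_le (t w : H) : q1 (conjq t * w) <= absq t * absq w.
Proof.
have [le0|gt0] := leP (q1 (conjq t * w)) 0.
  by rewrite (le_trans le0) // mulr_ge0 ?absq_ge0.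
rewrite -(@ler_pXn2r _ 2) ?nnegrE ?mulr_ge0 ?absq_ge0 ?(ltW gt0) //.
rewrite exprMn !sqr_absq !re_conjM.
case: t w {gt0} => [a b c d] [x y z s] /=.
rewrite -subr_ge0.
have -> : (a * a + b * b + c * c + d * d) * (x * x + y * y + z * z + s * s) -
  (a * x + b * y + c * z + d * s) ^+ 2 =
  (a * y - b * x) ^+ 2 + (a * z - c * x) ^+ 2 + (a * s - d * x) ^+ 2 +
  (b * z - c * y) ^+ 2 + (b * s - d * y) ^+ 2 + (c * s - d * z) ^+ 2 by ring.
by rewrite !addr_ge0 ?sqr_ge0.
Qed.

Lemma half_space_convex (t : H) c :
  @convex_set R H [set w | q1 (conjq t * w) <= c].
Proof.
move=> x y l /set_mem + /set_mem + ; rewrite inE /mkset.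
have -> : conv l x y = l%:num *: (x : H) + (1 - l%:num) *: (y : H) by [].
rewrite !re_conjM /=.
have : 0 <= l%:num by [].
have : l%:num <= 1 by [].
nra.
Qed.

Lemma hull_re_le (S : set H) t c : (forall w, S w -> q1 (conjq t * w) <= c) ->
  forall w, convex_hull S w -> q1 (conjq t * w) <= c.
Proof.
move=> Sc w Sw.
exact: (smallest_sub (@half_space_convex t c) (Sc : S `<=` _)  Sw).
Qed.

Lemma hull_re_ge (S : set H) t c : (forall w, S w -> c <= q1 (conjq t * w)) ->
  forall w, convex_hull S w -> c <= q1 (conjq t * w).
Proof.
have conjN w : q1 (conjq (- t) * w) = - q1 (conjq t * w).
  by rewrite !re_conjM /=; ring.
move=> Sc w Sw; rewrite -lerN2 -conjN; apply: (hull_re_le _ Sw) => u Su.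
by rewrite conjN lerN2; exact: Sc.
Qed.

End HalfSpaces.

(** * Support function and numerical radius *)

Section Pencil.
Variables (R : realType) (n : nat) (n_gt0 : (0 < n)%N).
Local Notation H := (quaternion R).
Variables (A : 'M[H]_n) (P : H -> 'M[R]_((n + n) + (n + n))).
Local Notation W x := ((adjq x *m A *m x) 0 0).
(* P t represents the functional Re (conj t * _) on the numerical range. *)
Hypothesis P_sym : forall t, P t \is symmetricmx.
Hypothesis P_form : forall t (x : 'cV[H]_n),
  qform (P t) (realify x) = q1 (conjq t * W x).

Let m_gt0 : (0 < (n + n) + (n + n))%N. Proof. by rewrite !addn_gt0 n_gt0. Qed.

Lemma numerical_range_pencil t :
  [set q1 (conjq t * w) | w in numerical_range A] =
  [set qform (P t) v | v in [set v | sqnorm v = 1]].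
Proof.
apply/seteqP; split=> c.
  move=> [_ [x /unit_normqv x1 <-] <-]; exists (realify x) => //; exact: P_form.
move=> [v v1 <-]; exists (W (quaternify v)).
  by exists (quaternify v) => //=; apply/unit_normqv; rewrite quaternifyK.
by rewrite -P_form quaternifyK.
Qed.

Lemma lambda_max_support t :
  is_max [set q1 (conjq t * w) | w in numerical_range A] (lambda_max (P t)).
Proof. by rewrite numerical_range_pencil; exact: rayleigh_max. Qed.

Lemma lambda_min_support t :
  is_min [set q1 (conjq t * w) | w in numerical_range A] (lambda_min (P t)).
Proof. by rewrite numerical_range_pencil; exact: rayleigh_min. Qed.

Local Notation coW := (convex_hull (numerical_range A)).

Lemma range_sub_hull : numerical_range A `<=` coW.
Proof. exact: sub_gen_smallest. Qed.

Lemma hull_max t : is_max [set q1 (conjq t * w) | w in coW] (lambda_max (P t)).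
Proof.
have [[w Ww wmax] ub] := lambda_max_support t.
split; first by exists w => //; exact: range_sub_hull.
move=> _ [u Wu <-]; apply: (hull_re_le _ Wu) => v Wv.
by apply: ub; exists v.
Qed.

Lemma hull_min t : is_min [set q1 (conjq t * w) | w in coW] (lambda_min (P t)).
Proof.
have [[w Ww wmin] lb] := lambda_min_support t.
split; first by exists w => //; exact: range_sub_hull.
move=> _ [u Wu <-]; apply: (hull_re_ge _ Wu) => v Wv.
by apply: lb; exists v.
Qed.

(** A hyperplane touching the hull and leaving it on one side sits at an
    attained bound of the functional, and such a bound is unique. *)
Lemma supporting_hyperplaneP t c : supporting_hyperplane coW t c <->
  c = lambda_min (P t) \/ c = lambda_max (P t).
Proof.
have [[u Wu umax] ub] := hull_max t.
have [[v Wv vmin] lb] := hull_min t.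
split=> [[[w Ww <-] [le|ge]]|[->|->]].
- right; apply/eqP; rewrite eq_le -{2}umax le // andbT.
  by apply: ub; exists w.
- left; apply/eqP; rewrite eq_le -{1}vmin ge //=.
  by apply: lb; exists w.
- split; first by exists v.
  by right=> w Ww; apply: lb; exists w.
- split; first by exists u.
  by left=> w Ww; apply: ub; exists w.
Qed.

(** The square of |x^* A x| is a polynomial in the real coordinates of x, the
    sum of the squares of the forms of the pencil at 1, i, j and k, so it has
    a maximum on the unit sphere. *)
Lemma numerical_radius_max :
  is_max [set absq w | w in numerical_range A] (numerical_radius A).
Proof.
pose f v := qform (P (Quat 1 0 0 0)) v ^+ 2 + qform (P (Quat 0 1 0 0)) v ^+ 2
  + qform (P (Quat 0 0 1 0)) v ^+ 2 + qform (P (Quat 0 0 0 1)) v ^+ 2.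
have fE x : f (realify x) = absq (W x) ^+ 2.
  by rewrite /f !P_form sqr_absq !re_conjM /=; ring.
have f_cont : continuous f.
  have sq_cont t : continuous (fun v => qform (P t) v ^+ 2).
    by move=> v; apply: (@cvgM _ _ (nbhs v) _ (qform (P t)) (qform (P t)));
      exact: qform_continuous.
  move=> v; exact: (cvgD (cvgD (cvgD (sq_cont _ v) (sq_cont _ v))
    (sq_cont _ v)) (sq_cont _ v)).
have [v /[!inE] /= v1 vmax] := compact_EVT_max (unit_sphere_neq0 R m_gt0)
  (@unit_sphere_compact R _) (continuous_subspaceT f_cont).
have vK := quaternifyK v.
have image : [set absq w | w in numerical_range A] =
   [set absq (W x) | x in [set x | normqv x = 1]].
  by rewrite image_comp.
suff rmax : is_max [set absq w | w in numerical_range A] (absq (W (quaternify v))).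
  by rewrite /numerical_radius -image (max_ofP rmax).
split.
  by exists (W (quaternify v)) => //; exists (quaternify v) => //=;
     apply/unit_normqv; rewrite vK.
move=> _ [_ [x /unit_normqv x1 <-] <-].
rewrite -(@ler_pXn2r _ 2) ?nnegrE ?absq_ge0 // -!fE vK.
by apply: vmax; rewrite inE.
Qed.

Lemma pencil_max_ball t : absq t <= 1 -> lambda_max (P t) <= numerical_radius A.
Proof.
move=> t1; have [[w Ww <-] _] := lambda_max_support t.
have [_ ub] := numerical_radius_max.
apply: (le_trans (re_conj_le t w)).
apply: (@le_trans _ _ (absq w)); last by apply: ub; exists w.
by rewrite ler_piMl ?absq_ge0.
Qed.

(** Cauchy-Schwarz is an equality at t = w / |w|, where w is a point of the
    numerical range with the largest modulus; if w = 0, any unit t will do. *)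
Lemma pencil_max_attained :
  exists2 t, absq t = 1 & lambda_max (P t) = numerical_radius A.
Proof.
have [[w Ww wr] _] := numerical_radius_max.
suff [t t1 tw] : exists2 t, absq t = 1 & q1 (conjq t * w) = absq w.
  exists t => //; apply/eqP; rewrite eq_le pencil_max_ball ?t1 //=.
  rewrite -wr -tw; have [_ ub] := lambda_max_support t.
  by apply: ub; exists w.
have [w0|w0] := eqVneq (absq w) 0.
  exists 1; last by rewrite w0 (absq_eq0 w0) mulr0.
  by rewrite /absq /= expr1n !expr0n /= !addr0 sqrtr1.
exists ((absq w)^-1 *: w).
  by rewrite absqZ ger0_norm ?invr_ge0 ?absq_ge0 // mulVf.
have -> : q1 (conjq ((absq w)^-1 *: w) * w) = (absq w)^-1 * q1 (conjq w * w).
  by rewrite !re_conjM /=; ring.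
by rewrite -sqr_absq expr2 mulKf.
Qed.

End Pencil.

(** * Real and imaginary parts of complex matrices *)

Section ComplexMatrix.
Variables (R : realType) (n : nat).

Lemma complex_mxE (X Y : 'M[R]_n) i j : complex_mx X Y i j = Complex (X i j) (Y i j).
Proof.
by rewrite !mxE; apply/eqP; rewrite eq_complex /=; apply/andP; split; apply/eqP; ring.
Qed.

Lemma complex_mx_herm (X Y : 'M[R]_n) :
  complex_mx X Y \is hermsymmx -> X^T = X /\ Y^T = - Y.
Proof.
move=> /is_hermitianmxP; rewrite expr0 scale1r => XY.
have XYe i j : Complex (X i j) (Y i j) = Complex (X j i) (- Y j i).
  by rewrite -complex_mxE XY 2!mxE complex_mxE.
by split; apply/matrixP => i j; rewrite !mxE; have [] := XYe j i.
Qed.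

Lemma complex_mx_tr (X Y : 'M[R]_n) : (complex_mx X Y)^T = complex_mx X^T Y^T.
Proof. by apply/matrixP => i j; rewrite complex_mxE [LHS]mxE complex_mxE !mxE. Qed.

Lemma complex_mxN (X Y : 'M[R]_n) : - complex_mx X Y = complex_mx (- X) (- Y).
Proof. by apply/matrixP => i j; rewrite complex_mxE [LHS]mxE complex_mxE !mxE. Qed.

Lemma complex_mx_inj (X Y X' Y' : 'M[R]_n) :
  complex_mx X Y = complex_mx X' Y' -> X = X' /\ Y = Y'.
Proof.
move=> XY; split; apply/matrixP => i j;
  by have := congr1 (fun Z : 'M_n => Z i j) XY; rewrite /= !complex_mxE => -[].
Qed.

End ComplexMatrix.

(** * Supporting hyperplanes and numerical radius of a quaternionic matrix *)

Theorem theorem4p1 (R : realType) (n : nat) (n_gt0 : (0 < n)%N)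
  (A : 'M[quaternion R]_n)
  (A1 A2 A11 A21 : 'M[complex R]_n)
  (E1 E2 F1 F2 S1 S2 T1 T2 : 'M[R]_n)
  (A_def : A = quaternion_mx A1 A2)
  (A1_def : A1 = A11 + Complex 0 1 *: A21)
  (A11_herm : A11 \is hermsymmx)
  (A21_herm : A21 \is hermsymmx)
  (EF1_def : A11 = complex_mx E1 F1)
  (EF2_def : A21 = complex_mx E2 F2)
  (S_def : 2%:R^-1 *: (A2 + A2^T) = complex_mx S1 S2)
  (T_def : 2%:R^-1 *: (A2 - A2^T) = complex_mx T1 T2) :
  let C1 := block4_mx
       E1    T1  (- F1) (- T2)
    (- T1)   E1  (- T2)    F1
       F1    T2     E1     T1
       T2 (- F1) (- T1)    E1 in
  let C2 := block4_mx
       E2    S2  (- F2)    S1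
       S2 (- E2) (- S1) (- F2)
       F2 (- S1)    E2     S2
       S1    F2     S2  (- E2) in
  let C3 := block4_mx
       S1    F2     S2  (- E2)
    (- F2)   S1  (- E2) (- S2)
       S2 (- E2) (- S1) (- F2)
    (- E2) (- S2)   F2  (- S1) in
  let C4 := block4_mx
       S2 (- E2) (- S1) (- F2)
    (- E2) (- S2)   F2  (- S1)
    (- S1) (- F2) (- S2)   E2
       F2 (- S1)    E2     S2 in
  let pencil (t : quaternion R) :=
    q1 t *: C1 + q2 t *: C2 + q3 t *: C3 + q4 t *: C4 in
  let coW := convex_hull (numerical_range A) in
  [/\ (* symmetry of E1, E2, S1, S2 and skew-symmetry of F1, F2, T1, T2 *)
      [/\ E1 \is symmetricmx, E2 \is symmetricmx,
          S1 \is symmetricmx & S2 \is symmetricmx] /\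
      [/\ F1 \is skewmx, F2 \is skewmx, T1 \is skewmx & T2 \is skewmx],
      (* (a) *)
      [/\ C1 \is symmetricmx, C2 \is symmetricmx,
          C3 \is symmetricmx & C4 \is symmetricmx],
      (* (b) *)
      forall t : quaternion R, absq t = 1 ->
        [/\ forall c : R, supporting_hyperplane coW t c <->
              c = lambda_min (pencil t) \/ c = lambda_max (pencil t),
            forall w : quaternion R, coW w ->
              lambda_min (pencil t) <= q1 (conjq t * w) <= lambda_max (pencil t),
            exists2 w : quaternion R, coW w & q1 (conjq t * w) = lambda_min (pencil t) &
            exists2 w : quaternion R, coW w & q1 (conjq t * w) = lambda_max (pencil t)]
    & (* (c) *)
      is_max [set lambda_max (pencil t) | t in [set t | absq t = 1]]
             (numerical_radius A) /\
      is_max [set lambda_max (pencil t) | t in [set t | absq t <= 1]]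
             (numerical_radius A)].
Proof.
move=> C1 C2 C3 C4 pencil coW.
have [E1s F1s] : E1^T = E1 /\ F1^T = - F1 by apply: complex_mx_herm; rewrite -EF1_def.
have [E2s F2s] : E2^T = E2 /\ F2^T = - F2 by apply: complex_mx_herm; rewrite -EF2_def.
have [S1s S2s] : S1^T = S1 /\ S2^T = S2.
  apply: complex_mx_inj; rewrite -complex_mx_tr -S_def.
  by rewrite linearZ linearD /= trmxK addrC.
have [T1s T2s] : T1^T = - T1 /\ T2^T = - T2.
  apply: complex_mx_inj; rewrite -complex_mx_tr -complex_mxN -T_def.
  by rewrite linearZ linearB /= trmxK -scalerN opprB.
have A_entries i j : A i j = Quat (E1 i j - F2 i j) (F1 i j + E2 i j)
    (S1 i j + T1 i j) (S2 i j + T2 i j).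
  have A1_ij : A1 i j = Complex (E1 i j - F2 i j) (F1 i j + E2 i j).
    rewrite A1_def EF1_def EF2_def [LHS]mxE [X in _ + X]mxE !complex_mxE.
    by apply/eqP; rewrite eq_complex /=; apply/andP; split; apply/eqP; ring.
  have A2_ij : A2 i j = Complex (S1 i j + T1 i j) (S2 i j + T2 i j).
    have -> : A2 = complex_mx S1 S2 + complex_mx T1 T2.
      rewrite -S_def -T_def -scalerDr addrACA subrr addr0 -mulr2n.
      by rewrite -[A2 *+ 2]scaler_nat scalerA mulVf ?scale1r // pnatr_eq0.
    by rewrite mxE !complex_mxE.
  rewrite A_def 3!mxE A1_ij A2_ij.
  by congr Quat => /=; ring.
have C1s := re_mx_sym E1s F1s T1s T2s.
have C2s := imi_mx_sym E2s S1s S2s F2s.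
have C3s := imj_mx_sym E2s S1s S2s F2s.
have C4s := imk_mx_sym E2s S1s S2s F2s.
have pencil_sym t : pencil t \is symmetricmx.
  apply/symmetricmxP; rewrite /pencil !linearD !linearZ /=.
  by rewrite C1s C2s C3s C4s.
have pencil_form t (x : 'cV[quaternion R]_n) :
    qform (pencil t) (realify x) = q1 (conjq t * (adjq x *m A *m x) 0 0).
  rewrite re_conjM !qform_add !qform_scale.
  by have [-> -> -> ->] := quadratic_form_components E1s E2s S1s S2s F1s F2s T1s T2s A_entries x.
split.
- by split; split; try apply/symmetricmxP; try apply/skewmxP.
- by split; apply/symmetricmxP.
- move=> t t1; split.
  + exact: supporting_hyperplaneP.
  + move=> w Ww; have [_ ub] := hull_max n_gt0 pencil_sym pencil_form t.
    have [_ lb] := hull_min n_gt0 pencil_sym pencil_form t.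
    by apply/andP; split; [apply: lb; exists w|apply: ub; exists w].
  + by have [[w]] := hull_min n_gt0 pencil_sym pencil_form t; exists w.
  + by have [[w]] := hull_max n_gt0 pencil_sym pencil_form t; exists w.
- have [t t1 tr] := pencil_max_attained n_gt0 pencil_sym pencil_form.
  have ball := pencil_max_ball n_gt0 pencil_sym pencil_form.
  split; split.
  + by exists t.
  + by move=> _ [u /= u1 <-]; apply: ball; rewrite u1.
  + by exists t => //=; rewrite t1.
  + by move=> _ [u /= u1 <-]; exact: ball.
Qed.
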